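(* If $D$ is a digraph and $D'$ is a butterfly minor of $D$, then $\mathrm{cycw}(D')\le\mathrm{cycw}(D)$.
   Context: For $X\subseteq V(D)$, $\partial(X)$ is the set of arcs with exactly one endpoint in $X$. A cycle decomposition of $D$ is $(T,\varphi)$, $T$ a cubic tree (non-leaf vertices of degree $3$), $\varphi$ a bijection from the leaves of $T$ to $V(D)$; for $e\in E(T)$, $\partial(e)=\partial(\varphi(\text{leaves of }T_1))$ with $T_1$ a component of $T-e$; its cycle porosity is the maximum over families $\mathcal{C}$ of pairwise vertex-disjoint directed cycles of $D$ of $|\partial(e)\cap\bigcup_{C\in\mathcal C}E(C)|$. The width is the maximum cycle porosity over tree edges; $\mathrm{cycw}(D)$ is the minimum width of a cycle decomposition. An arc $(u,v)$ is butterfly-contractible if it is the only arc leaving $u$ or the only arc entering $v$; butterfly contracting it replaces $u,v$ by a new vertex $x_{u,v}$ with arcs $(w,x_{u,v})$ whenever $(w,u)$ or $(w,v)$ was an arc and $(x_{u,v},w)$ whenever $(u,w)$ or $(v,w)$ was an arc. A butterfly minor of $D$ is a digraph obtained from a subgraph of $D$ by butterfly contractions. *)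

(* Defs.v *)
From mathcomp Require Import all_boot.
From mathcomp Require Import boolp.

Set Implicit Arguments.
Unset Strict Implicit.
Unset Printing Implicit Defensive.

(* Finite digraphs without parallel arcs; antiparallel arcs are allowed.  Loops
   are not excluded; loopless digraphs are closed under all operations below. *)
Record digraph := Digraph {
  vertex :> finType;
  arc : rel vertex
}.

Record sgraph := SGraph {
  svertex :> finType;
  edge : rel svertex;
  edge_sym : symmetric edge;
  edge_irr : irreflexive edge
}.

Section Trees.
Variable T : sgraph.

Definition is_tree : Prop :=
  [/\ 0 < #|T|,
      (forall x y : T, connect (@edge T) x y)
    & (forall c : seq T, 2 < size c -> ~ ucycle (@edge T) c)].

Definition degree (x : T) : nat := #|[set y | edge x y]|.

(* Degree 0 only occurs in the one-vertex tree, whose vertex counts as a leaf,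
   so that digraphs with a single vertex have a decomposition. *)
Definition leaf (x : T) : bool := degree x <= 1.

Definition is_cubic_tree : Prop :=
  is_tree /\ (forall x : T, ~~ leaf x -> degree x = 3).

Definition edge_del (s t : T) : rel T :=
  [rel x y | edge x y && ((x, y) != (s, t)) && ((x, y) != (t, s))].

Definition edge_comp (s t : T) : {set T} :=
  [set x | connect (edge_del s t) s x].

End Trees.

Section Porosity.
Variable D : digraph.

Definition cut (X : {set D}) : {set D * D} :=
  [set a | arc a.1 a.2 & (a.1 \in X) != (a.2 \in X)].

(* A directed cycle is represented by its set of arcs. *)
Definition cycle_arcs (c : seq D) : {set D * D} :=
  [set (x, next c x) | x in c].

Definition is_dicycle (C : {set D * D}) : Prop :=
  exists c : seq D, [/\ c != [::], ucycle (@arc D) c & C = cycle_arcs c].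

Definition cycle_vertices (C : {set D * D}) : {set D} :=
  [set a.1 | a in C].

Definition disjoint_dicycles (F : {set {set D * D}}) : Prop :=
  (forall C, C \in F -> is_dicycle C) /\
  (forall C1 C2, C1 \in F -> C2 \in F -> C1 != C2 ->
     [disjoint cycle_vertices C1 & cycle_vertices C2]).

Definition cycle_porosity (X : {set D}) : nat :=
  \max_(F : {set {set D * D}} | `[< disjoint_dicycles F >])
     #|cut X :&: \bigcup_(C in F) C|.

End Porosity.

Record cycle_decomposition (D : digraph) := CycleDecomposition {
  dec_tree : sgraph;
  dec_cubic : is_cubic_tree dec_tree;
  dec_map : {x : dec_tree | leaf x} -> D;
  dec_bij : bijective dec_map
}.

Section Width.
Variables (D : digraph) (d : cycle_decomposition D).

Definition leaf_side (s t : dec_tree d) : {set D} :=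
  [set dec_map l | l : {x : dec_tree d | leaf x} & val l \in edge_comp s t].

(* Every tree edge is visited in both orientations, hence with either choice of
   the component of T - e. *)
Definition width : nat :=
  \max_(e : dec_tree d * dec_tree d | edge e.1 e.2)
     cycle_porosity (leaf_side e.1 e.2).

End Width.

Definition has_width (D : digraph) (k : nat) : Prop :=
  exists d : cycle_decomposition D, width d = k.

(* The default 0 concerns only the digraph without vertices, the only one that
   has no cycle decomposition. *)
Definition cycw (D : digraph) : nat :=
  if pselect (exists k, `[< has_width D k >]) is left ex
  then ex_minn ex else 0.

Definition digraph_iso (D D' : digraph) : Prop :=
  exists2 f : D -> D', bijective f & forall x y, arc (f x) (f y) = arc x y.

(* Up to isomorphism: H is a digraph on a subset of the vertices of D with a
   subset of the arcs of D between them. *)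
Definition subgraph (H D : digraph) : Prop :=
  exists2 f : H -> D, injective f & forall x y, arc x y -> arc (f x) (f y).

Definition butterfly_contractible (D : digraph) (u v : D) : Prop :=
  arc u v /\
  ((forall w, arc u w -> w = v) \/ (forall w, arc w v -> w = u)).

Section Contraction.
Variables (D : digraph) (u v : D).

(* None is the new vertex x_{u,v}; w below ranges over the remaining vertices,
   so contracting one arc of a digon creates no loop. *)
Definition contract_vertex : finType :=
  option {x : D | (x != u) && (x != v)}.

Definition contract_arc : rel contract_vertex := fun a b =>
  match a, b with
  | Some w, Some z => arc (val w) (val z)
  | Some w, None => arc (val w) u || arc (val w) v
  | None, Some w => arc u (val w) || arc v (val w)
  | None, None => false
  end.

Definition contract : digraph := Digraph contract_arc.

End Contraction.

Inductive butterfly_contracts : digraph -> digraph -> Prop :=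
| bc_iso (D D' : digraph) : digraph_iso D D' -> butterfly_contracts D D'
| bc_step (D D' : digraph) (u v : D) :
    butterfly_contractible u v ->
    butterfly_contracts (contract u v) D' -> butterfly_contracts D D'.

Definition butterfly_minor (D' D : digraph) : Prop :=
  exists2 H : digraph, subgraph H D & butterfly_contracts H D'.

(* Main.v *)
(** For a digraph, replacing each family of disjoint directed cycles by the
    injective self-map that sends every vertex to its successor on its cycle
    (and fixes the other vertices) turns the porosity of a cut [X] into the
    largest number of vertices that such a map moves across [X]. If [D'] is a
    butterfly minor of [D], an injection [f] of [D'] into [D] lets these maps
    be lifted from [D'] to [D]; for a contraction, the one cycle through the
    new vertex may need a detour through the endpoint missed by [f], and this
    never loses a crossing. Hence the porosity of [f^-1 X] is at most that of
    [X]. A decomposition of [D] then yields one of [D'] by deleting the leaves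
    outside the image of [f] one at a time and suppressing their parents: each
    edge of the new tree induces the trace of a bipartition induced by an edge
    of the old one. *)

From mathcomp Require Import all_boot.
From mathcomp Require Import boolp perm zify.
(* Imported last so that [arc] is not hidden by that of [path]. *)
Require Import Defs.

Set Implicit Arguments.
Unset Strict Implicit.
Unset Printing Implicit Defensive.

(** * Porosity through injective maps *)

Section ArcMoves.
Variable D : digraph.

(** Injectivity on a finite type makes [s] a permutation, whose nontrivial orbits are disjoint
    directed cycles. Fixed points stand for uncovered vertices; a loop also becomes a fixed point,
    which is harmless because loops cross no cut. *)
Definition arc_moves (s : D -> D) : Prop :=
  injective s /\ forall x, s x = x \/ arc x (s x).

Definition crossings (X : {set D}) (s : D -> D) : {set D} :=
  [set x | (x \in X) != (s x \in X)].

Lemma disjoint_dicycles_orbits (s : D -> D) : arc_moves s ->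
  disjoint_dicycles
    [set [set (y, s y) | y in orbit s x] | x in [pred x | s x != x]].
Proof.
case=> s_inj s_arc.
have moved x y : s x != x -> y \in orbit s x -> s y != y.
  rewrite -fconnect_orbit => sx xy.
  have inv : invariant s (fun z => s z == z) =1 xpredT.
    by move=> z; rewrite /= inj_eq ?eqxx.
  by rewrite -(fconnect_invariant inv xy).
split=> [C /imsetP [x xP ->] | C1 C2 /imsetP [x _ ->] /imsetP [y _ ->] neq].
  exists (orbit s x); split.
  - by apply/eqP => o0; have := in_orbit s x; rewrite o0.
  - apply/andP; split; last exact: orbit_uniq.
    apply: cycle_from_next; first exact: orbit_uniq.
    move=> y yx; rewrite (nextE (cycle_orbit s_inj x) yx).
    by case: (s_arc y) (moved _ _ xP yx) => [-> | //]; rewrite eqxx.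
  - apply: eq_in_imset => y yx.
    by rewrite (nextE (cycle_orbit s_inj x) yx).
apply/pred0P => z /=; apply/negP => /andP [].
move=> /imsetP [_ /imsetP [z1 zx ->] /= ->] /imsetP [_ /imsetP [z2 zy ->] /= ez].
case/negP: neq; apply/eqP/setP => a; subst z2.
have xy : fconnect s x y.
  apply: (@connect_trans _ _ z1); first by rewrite fconnect_orbit.
  by rewrite fconnect_sym // fconnect_orbit.
apply/imsetP/imsetP => -[b b_in ->]; exists b => //; move: b_in;
  rewrite -!fconnect_orbit.
- by apply: connect_trans; rewrite fconnect_sym.
- exact: connect_trans.
Qed.

Lemma dicycle_arc (C : {set D * D}) (a : D * D) :
  is_dicycle C -> a \in C -> arc a.1 a.2.
Proof.
move=> [c [_ /andP [c_cyc _] ->]] /imsetP [x xc ->] /=.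
exact: next_cycle c_cyc xc.
Qed.

Lemma mem_cycle_vertices (C : {set D * D}) (a : D * D) :
  is_dicycle C -> a \in C ->
  a.1 \in cycle_vertices C /\ a.2 \in cycle_vertices C.
Proof.
move=> [c [_ _ ->]] /imsetP [x xc ->] /=; split; apply/imsetP.
  by exists (x, next c x) => //; apply/imsetP; exists x.
exists (next c x, next c (next c x)) => //; apply/imsetP.
by exists (next c x); rewrite ?mem_next.
Qed.

Lemma dicycle_biunique (C : {set D * D}) (a b : D * D) :
  is_dicycle C -> a \in C -> b \in C -> (a.1 == b.1) = (a.2 == b.2).
Proof.
move=> [c [_ /andP [_ c_uniq] ->]] /imsetP [x xc ->] /imsetP [y yc ->] /=.
by rewrite (can_eq (prev_next c_uniq)).
Qed.

Lemma crossings_le_porosity (X : {set D}) (s : D -> D) :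
  arc_moves s -> #|crossings X s| <= cycle_porosity X.
Proof.
move=> sP; have FP := disjoint_dicycles_orbits sP.
set F := (X in disjoint_dicycles X) in FP.
apply: leq_trans (leq_bigmax_cond F _); last exact/asboolP.
have g_inj : injective (fun x => (x, s x)) by move=> x y [].
rewrite -(card_imset (mem (crossings X s)) g_inj).
apply/subset_leq_card/subsetP => a /imsetP [x + ->].
rewrite inE => cross; rewrite !inE /= cross andbT.
have sx : s x != x by apply: contraNneq cross => ->.
have [| -> /=] := sP.2 x; first by move/eqP; rewrite (negPf sx).
apply/bigcupP; exists [set (y, s y) | y in orbit s x]; apply/imsetP.
  by exists x.
by exists x => //; apply: in_orbit.
Qed.

Lemma dicycles_arc_moves (X : {set D}) (F : {set {set D * D}}) :
  disjoint_dicycles F ->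
  exists2 s, arc_moves s &
    #|cut X :&: \bigcup_(C in F) C| <= #|crossings X s|.
Proof.
move=> [F_cyc F_disj]; set A := \bigcup_(C in F) C.
have A_eq a b : a \in A -> b \in A -> (a.1 == b.1) = (a.2 == b.2).
  move=> /bigcupP [C CF aC] /bigcupP [C' CF' bC'].
  have [a1 a2] := mem_cycle_vertices (F_cyc C CF) aC.
  have [b1 b2] := mem_cycle_vertices (F_cyc C' CF') bC'.
  have [eqC | neqC] := eqVneq C C'.
    by rewrite -eqC in bC'; apply: dicycle_biunique aC bC'; apply: F_cyc.
  have disj := F_disj C C' CF CF' neqC.
  have [e1 | _] := eqVneq a.1 b.1.
    by move: (disjointFr disj a1); rewrite e1 b1.
  have [e2 | //] := eqVneq a.2 b.2.
  by move: (disjointFr disj a2); rewrite e2 b2.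
(* Needed for injectivity of the successor map: a moved vertex never lands on a fixed one. *)
have A_next a : a \in A -> exists y, (a.2, y) \in A.
  move=> /bigcupP [C CF aC].
  have [_ /imsetP [b bC ->]] := mem_cycle_vertices (F_cyc C CF) aC.
  by exists b.2; apply/bigcupP; exists C => //; case: b bC.
pose s x := if [pick y | (x, y) \in A] is Some y then y else x.
have sA x y : (x, y) \in A -> s x = y.
  rewrite /s; case: pickP => [z xz xy | no xy]; last by rewrite no in xy.
  by apply/eqP; rewrite -(A_eq _ _ xz xy) /= eqxx.
have sN x : (forall y, (x, y) \notin A) -> s x = x.
  by move=> no; rewrite /s; case: pickP => [z xz | //]; case/negP: (no z).
have sP x : {y | (x, y) \in A} + {forall y, (x, y) \notin A}.
  case: (pickP [pred y | (x, y) \in A]) => /= [y | no]; first by left; exists y.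
  by right=> y; have /= -> := no y.
exists s.
  split=> [x y | x].
    case: (sP x) => [[x' xx'] | nox]; case: (sP y) => [[y' yy'] | noy].
    - rewrite (sA _ _ xx') (sA _ _ yy') => e.
      by apply/eqP; rewrite (A_eq _ _ xx' yy') /= e.
    - rewrite (sA _ _ xx') (sN _ noy) => e; subst x'.
      by have [z yz] := A_next _ xx'; case/negP: (noy z).
    - rewrite (sA _ _ yy') (sN _ nox) => e; subst y'.
      by have [z yz] := A_next _ yy'; case/negP: (nox z).
    - by rewrite !sN.
  case: (sP x) => [[x' xx'] | nox]; last by left; apply: sN.
  right; rewrite (sA _ _ xx'); case/bigcupP: xx' => C CF.
  exact: dicycle_arc (F_cyc C CF).
(* Distinct arcs of [A] have distinct tails, so the arcs in the cut may be counted by their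
   tails. *)
rewrite -(card_in_imset (f := fst) (D := mem (cut X :&: A))).
  apply/subset_leq_card/subsetP => _ /imsetP [[x y] + ->] /=.
  by rewrite !inE /= => /andP [/andP [_ +] /sA ->].
move=> [x y] [x' y']; rewrite !inE => /andP [_ a] /andP [_ b] /= e.
by apply/eqP; rewrite xpair_eqE -(A_eq _ _ a b) /= e eqxx.
Qed.

Lemma porosity_le_iff (X : {set D}) (n : nat) :
  (forall s, arc_moves s -> #|crossings X s| <= n) <-> cycle_porosity X <= n.
Proof.
split=> [le_n | le_n s sP];
  last exact: leq_trans (crossings_le_porosity X sP) le_n.
apply/bigmax_leqP => F /asboolP /(@dicycles_arc_moves X) [s sP le_s].
exact: leq_trans le_s (le_n _ sP).
Qed.

End ArcMoves.

(** * Embeddings that do not increase porosity *)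

Definition porosity_embeds (D' D : digraph) : Prop :=
  exists2 f : D' -> D, injective f &
    forall X : {set D}, cycle_porosity (f @^-1: X) <= cycle_porosity X.

Lemma porosity_embeds_trans (D1 D2 D3 : digraph) :
  porosity_embeds D1 D2 -> porosity_embeds D2 D3 -> porosity_embeds D1 D3.
Proof.
move=> [f f_inj fP] [g g_inj gP]; exists (g \o f); first exact: inj_comp.
move=> X; apply: leq_trans (gP X); apply: leq_trans (fP _).
by rewrite (_ : _ @^-1: X = f @^-1: (g @^-1: X)) //; apply/setP=> x;
  rewrite !inE.
Qed.

Section Lift.
Variables (V' V : finType) (f : V' -> V) (f_inj : injective f).

Definition lift_fun (s : V' -> V') (x : V) : V :=
  if [pick y | f y == x] is Some y then f (s y) else x.

Lemma lift_fun_in s y : lift_fun s (f y) = f (s y).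
Proof.
rewrite /lift_fun; case: pickP => [z /eqP /f_inj -> // | no].
by have := no y; rewrite /= eqxx.
Qed.

Lemma lift_fun_out s x : (forall y, f y <> x) -> lift_fun s x = x.
Proof. by rewrite /lift_fun; case: pickP => [z /eqP fz no | //];
  case: (no z). Qed.

Lemma image_or_not x : {y | x = f y} + {forall y, f y <> x}.
Proof.
case: (pickP [pred y | f y == x]) => [y /eqP e | no]; first by left; exists y.
by right=> y e; have := no y; rewrite /= e eqxx.
Qed.

Lemma lift_fun_inj s : injective s -> injective (lift_fun s).
Proof.
move=> s_inj x y.
case: (image_or_not x) => [[x' ->] | nox];
  case: (image_or_not y) => [[y' ->] | noy].
- by rewrite !lift_fun_in => /f_inj /s_inj ->.
- by rewrite lift_fun_in lift_fun_out // => /noy.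
- by rewrite lift_fun_in lift_fun_out // => /esym /nox.
- by rewrite !lift_fun_out.
Qed.

End Lift.

(* It suffices to lift the partial rotation given by a family of disjoint
   cycles of [D'], keeping at least as many crossings of every cut. *)
Lemma porosity_embeds_lift (D' D : digraph) (f : D' -> D) : injective f ->
  (forall s, arc_moves s -> exists2 t, arc_moves t &
     forall X : {set D}, #|crossings (f @^-1: X) s| <= #|crossings X t|) ->
  porosity_embeds D' D.
Proof.
move=> f_inj lifts; exists f => // X; apply/porosity_le_iff => s /lifts [t tP].
move=> /(_ X) /leq_trans; apply; exact: crossings_le_porosity.
Qed.

Section ArcLift.
Variables (D' D : digraph) (f : D' -> D) (f_inj : injective f).

Lemma arc_moves_lift (s : D' -> D') : injective s ->
  (forall y, s y = y \/ arc (f y) (f (s y))) ->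
  exists2 t, arc_moves t &
    forall X : {set D}, #|crossings (f @^-1: X) s| <= #|crossings X t|.
Proof.
move=> s_inj s_arc; exists (lift_fun f s).
  split=> [|x]; first exact: lift_fun_inj.
  case: (image_or_not f x) => [[y ->] | no]; last by left; apply: lift_fun_out.
  by rewrite lift_fun_in //; case: (s_arc y) => [-> |]; [left | right].
move=> X; rewrite -(card_imset (mem (crossings _ s)) f_inj).
apply/subset_leq_card/subsetP => _ /imsetP [y + ->].
by rewrite !inE lift_fun_in.
Qed.

(* If the step from [f y0] to [f (s y0)] crosses [X], so does one of the two
   steps of the detour through [c]. *)
Lemma arc_moves_detour (s : D' -> D') (y0 : D') (c : D) : injective s ->
  (forall y, f y <> c) ->
  (forall y, y <> y0 -> s y = y \/ arc (f y) (f (s y))) ->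
  arc (f y0) c -> arc c (f (s y0)) ->
  exists2 t, arc_moves t &
    forall X : {set D}, #|crossings (f @^-1: X) s| <= #|crossings X t|.
Proof.
move=> s_inj c_out s_arc arc_c c_arc.
(* The transposition inserts [c] into the orbit: [f y0] goes to [c], which the lift fixes, and [c]
   goes where the lift sends [f y0]. *)
pose t x := lift_fun f s (tperm (f y0) c x).
have t0 : t (f y0) = c by rewrite /t tpermL lift_fun_out.
have tc : t c = f (s y0) by rewrite /t tpermR lift_fun_in.
have tf y : y <> y0 -> t (f y) = f (s y).
  move=> /eqP neq; rewrite /t tpermD ?lift_fun_in //.
    by rewrite (inj_eq f_inj) eq_sym.
  by rewrite eq_sym; apply/eqP.
exists t.
  split=> [x x' /(lift_fun_inj f_inj s_inj) /perm_inj // | x].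
  have [-> | /eqP xc] := eqVneq x c; first by right; rewrite tc.
  case: (image_or_not f x) => [[y ->] | no].
    have [-> | /eqP neq] := eqVneq y y0; first by right; rewrite t0.
    by rewrite tf //; case: (s_arc y neq) => [-> |]; [left | right].
  left; rewrite /t tpermD ?lift_fun_out //; apply/eqP => // e.
  by case: xc.
move=> X.
(* [h] charges each crossing of [s] to a crossing of [t]. At [y0] the charge goes to [c] exactly
   when the first step of the detour stays on one side of [X]. *)
pose h y := if (y == y0) && ((f y0 \in X) == (c \in X)) then c else f y.
have h_inj : injective h.
  move=> y y'; rewrite /h.
  case: (altP (y =P y0)) => [-> | _]; case: (altP (y' =P y0)) => [-> | _] //=;
    try case: ifP => _; try exact: f_inj; try by move/c_out.
  by move/esym/c_out.
rewrite -(card_imset (mem (crossings _ s)) h_inj).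
apply/subset_leq_card/subsetP => _ /imsetP [y + ->].
rewrite !inE /h; have [-> | /eqP neq] /= := eqVneq y y0; last by rewrite tf.
by case: ifP => [/eqP <- | /negbT]; rewrite ?tc ?t0.
Qed.

End ArcLift.

Lemma subgraph_porosity_embeds (H D : digraph) :
  subgraph H D -> porosity_embeds H D.
Proof.
move=> [f f_inj f_arc]; apply: (porosity_embeds_lift f_inj) => s [s_inj s_arc].
apply: arc_moves_lift => // y.
by case: (s_arc y) => [| /f_arc]; [left | right].
Qed.

Lemma iso_porosity_embeds (D D' : digraph) :
  digraph_iso D D' -> porosity_embeds D' D.
Proof.
move=> [f [g fK gK] f_arc]; apply: subgraph_porosity_embeds.
by exists g => [|x y]; [apply: can_inj gK | rewrite -f_arc !gK].
Qed.

(** * Porosity under contraction of an arc *)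

Section ContractEmbedding.
Variables (D : digraph) (u v : D).

Definition expand (b : D) (a : contract u v) : D :=
  if a is Some w then val w else b.

Lemma expandS (b c : D) w : (c == u) || (c == v) -> expand b (Some w) <> c.
Proof.
move=> c_uv /= e; case/andP: (valP w) c_uv; rewrite /= e.
by move=> /negPf -> /negPf ->.
Qed.

Lemma expand_inj (b : D) : (b == u) || (b == v) -> injective (expand b).
Proof.
move=> b_uv [w|] [z|] // => [/= e | /(expandS b_uv) | /esym /(expandS b_uv)] //.
by congr Some; apply: val_inj.
Qed.

Lemma expand_out (b c : D) : (c == u) || (c == v) -> b != c ->
  forall a, expand b a <> c.
Proof. by move=> c_uv /eqP bc [w|] //; apply: expandS. Qed.

(* The endpoint of the contracted arc that keeps its other arcs represents the
   new vertex; the other endpoint serves as a detour when needed. *)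
Lemma contract_porosity_embeds :
  butterfly_contractible u v -> porosity_embeds (contract u v) D.
Proof.
case=> uv [out_u | in_v].
  apply: (porosity_embeds_lift (f := expand v)) => [|s [s_inj s_arc]].
    by apply: expand_inj; rewrite eqxx orbT.
  have v_inj : injective (expand v) by apply: expand_inj; rewrite eqxx orbT.
  (* Since [u] has no out-neighbour but [v], every arc leaving the new vertex comes from [v]. Only
     an arc entering the new vertex can fail to lift, when it ends in [u] alone. *)
  have stepN (a : contract u v) :
      (forall w, a = Some w -> s a = None -> arc (val w) v) ->
      s a = a \/ arc (expand v a) (expand v (s a)).
    case: (s_arc a) => [-> | ]; first by left.
    case: a => [w|]; case es: (s _) => [z|] //=; try by right.
      by move=> _ a_v; right; apply: a_v.
    case/orP => [/out_u e | vz _]; last by right.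
    by case/andP: (valP z); rewrite /= e eqxx.
  (* By injectivity at most one [w] is sent to the new vertex, so a single detour from [w] through
     [u] to [v] is enough. *)
  have [/existsP [w /andP [/eqP sw wv]] | no] :=
    boolP [exists w, (s (Some w) == None) && ~~ arc (val w) v].
    have wu : arc (val w) u.
      by case: (s_arc (Some w)); rewrite sw //= (negPf wv) orbF.
    have neq : v != u by move: (val w) wu wv => x xu; apply: contraNneq => ->.
    apply: (arc_moves_detour (c := u) v_inj s_inj (y0 := Some w)) => //.
    - by apply: expand_out; rewrite ?eqxx.
    - move=> a aw; apply: stepN => z az sa; case: aw.
      by apply: s_inj; rewrite sa sw.
    - by rewrite sw.
  apply: arc_moves_lift => // a; apply: stepN => w aw sa; subst a.
  by move/existsPn: no => /(_ w); rewrite sa eqxx negbK.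
apply: (porosity_embeds_lift (f := expand u)) => [|s [s_inj s_arc]].
  by apply: expand_inj; rewrite eqxx.
have u_inj : injective (expand u) by apply: expand_inj; rewrite eqxx.
(* The mirror case: arcs entering the new vertex end in [u], and only the step leaving it may need
   the detour from [u] through [v]. *)
have stepN (a : contract u v) :
    (forall z, a = None -> s a = Some z -> arc u (val z)) ->
    s a = a \/ arc (expand u a) (expand u (s a)).
  case: (s_arc a) => [-> | ]; first by left.
  case: a => [w|]; case es: (s _) => [z|] //=; try by right.
    case/orP => [wu _ | /in_v e]; first by right.
    by case/andP: (valP w); rewrite /= e eqxx.
  by move=> _ a_u; right; apply: a_u.
case es: (s None) => [z|]; last first.
  by apply: arc_moves_lift => // a; apply: stepN => z ->; rewrite es.
have [uz | uz] := boolP (arc u (val z)).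
  by apply: arc_moves_lift => // a; apply: stepN => z' ->; rewrite es => -[<-].
have vz : arc v (val z).
  by case: (s_arc None); rewrite es //= (negPf uz).
have neq : u != v by move: (val z) uz vz => x ux vx; apply: contraNneq ux => ->.
apply: (arc_moves_detour (c := v) u_inj s_inj (y0 := None)) => //.
- by apply: expand_out; rewrite ?eqxx ?orbT.
- by move=> a aN; apply: stepN.
- by rewrite es.
Qed.

End ContractEmbedding.

Lemma minor_porosity_embeds (D' D : digraph) :
  butterfly_minor D' D -> porosity_embeds D' D.
Proof.
move=> [H /subgraph_porosity_embeds HD HD'].
apply: porosity_embeds_trans HD.
elim: HD' => [D1 D2 | D1 D2 u v uv _]; first exact: iso_porosity_embeds.
by move/porosity_embeds_trans; apply; apply: contract_porosity_embeds.
Qed.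

(** * Deleting a leaf of a cubic tree *)

Lemma connect_hom (T T' : finType) (e : rel T) (e' : rel T') (h : T -> T') :
  (forall x y, e x y -> connect e' (h x) (h y)) ->
  forall x y, connect e x y -> connect e' (h x) (h y).
Proof.
move=> hom x y /connectP [p + ->]; elim: p x => [|z p IH] x //=.
by case/andP => /hom xz /IH; apply: connect_trans.
Qed.

Section Bridges.
Variable T : sgraph.

Definition acyclic : Prop :=
  forall c : seq T, 2 < size c -> ~ ucycle (@edge T) c.

Lemma edge_del_sym (s t : T) : symmetric (edge_del s t).
Proof.
by move=> x y; rewrite /edge_del /= edge_sym !xpair_eqE; do ![case: eqP => ?];
  rewrite ?andbT ?andbF.
Qed.

Lemma edge_delE (s t x y : T) :
  edge_del s t x y = [&& edge x y, (x, y) != (s, t) & (x, y) != (t, s)].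
Proof. by rewrite /edge_del /= andbA. Qed.

Lemma edge_connect_sym : connect_sym (@edge T).
Proof. by apply: sym_connect_sym; apply: edge_sym. Qed.

Lemma edge_del_connect_sym (s t : T) : connect_sym (edge_del s t).
Proof. by apply: sym_connect_sym; apply: edge_del_sym. Qed.

Lemma edge_neq (x y : T) : edge x y -> x != y.
Proof. by apply: contraTneq => ->; rewrite edge_irr. Qed.

Lemma acyclic_bridge (s t : T) :
  acyclic -> edge s t -> ~~ connect (edge_del s t) s t.
Proof.
move=> acyc st; apply/connectP => -[p0 p0_path p0_last].
case/shortenP: p0_path p0_last => p p_path p_uniq _ p_last.
case: p p_path p_uniq p_last => [|x [|y p]] p_path p_uniq p_last.
- by move: st; rewrite p_last edge_irr.
- by move: p_path; rewrite p_last /= edge_delE eqxx /= andbF.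
rewrite /= in p_last.
apply: (acyc [:: s, x, y & p]) => //; rewrite /ucycle p_uniq andbT /=.
have sub : subrel (edge_del s t) (@edge T).
  by move=> a b; rewrite edge_delE => /and3P [].
have /= := sub_path sub p_path.
by rewrite rcons_path -p_last [edge t s]edge_sym st andbT.
Qed.

(** Going the other way round a cycle joins the ends of its first edge without using that edge. This
    criterion suits the modified tree, where connectivity after deleting an edge is computed
    anyway. *)
Lemma bridges_acyclic :
  (forall s t : T, edge s t -> ~~ connect (edge_del s t) s t) -> acyclic.
Proof.
move=> bridge [|x [|y [|z c]]] //= _ /andP [/= /and3P [xy yz c_path]].
rewrite !inE !negb_or => /and3P [/and3P [x_y x_z x_c] /andP [y_z y_c] _].
case/negP: (bridge x y xy).
rewrite rcons_path in c_path; case/andP: c_path => c_path c_last.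
rewrite edge_del_connect_sym; apply: (@connect_trans _ _ z).
  apply: connect1; rewrite edge_delE yz !xpair_eqE.
  by rewrite [y == x]eq_sym [z == x]eq_sym (negPf x_y) (negPf x_z) andbF.
apply: (@connect_trans _ _ (last z c)).
  apply/connectP; exists c => //.
  (* The rest of the cycle avoids [x], hence also the deleted edge. *)
  apply: (sub_in_path (P := [pred w | w != x])) c_path => [a b|].
    rewrite !inE edge_delE !xpair_eqE => /negPf ax /negPf bx ->.
    by rewrite ax bx andbF.
  rewrite /= eq_sym x_z /=; apply/allP => w wc /=.
  by apply: contraNneq x_c => <-.
apply: connect1; rewrite edge_delE c_last !xpair_eqE.
have zc := mem_last z c.
have /negPf -> : last z c != x.
  apply: contraTneq zc => ->; by rewrite inE negb_or x_z.
have /negPf -> : last z c != y.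
  by apply: contraTneq zc => ->; rewrite inE negb_or y_z.
by [].
Qed.

(** Two neighbours of a vertex are never adjacent, so joining them when that vertex is suppressed
    creates a genuinely new edge. *)
Lemma acyclic_no_triangle (x y z : T) :
  acyclic -> edge x y -> edge y z -> ~~ edge x z.
Proof.
move=> acyc xy yz; apply/negP => xz; apply: (acyc [:: x; y; z]) => //.
rewrite /ucycle /= !inE xy yz edge_sym xz negb_or.
by rewrite (edge_neq xy) (edge_neq xz) (edge_neq yz).
Qed.

End Bridges.

Section DeleteLeaf.
Variables (T : sgraph) (T_tree : is_tree T) (u p : T).
Hypothesis u_nbr : forall x, edge u x = (x == p).
Hypothesis p_deg : degree p = 3.

Definition kept : finType := {x : T | (x != u) && (x != p)}.

(** Suppression of [p]: without [u] it has two neighbours left, which become adjacent. *)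
Definition kept_edge : rel kept := fun x y =>
  edge (val x) (val y) || [&& x != y, edge (val x) p & edge p (val y)].

Lemma kept_edge_sym : symmetric kept_edge.
Proof.
move=> x y; rewrite /kept_edge edge_sym [y == x]eq_sym; congr (_ || _).
by rewrite [edge p _]edge_sym [edge _ p]edge_sym [edge p _ && _]andbC.
Qed.

Lemma kept_edge_irr : irreflexive kept_edge.
Proof. by move=> x; rewrite /kept_edge edge_irr eqxx. Qed.

Definition delete_leaf : sgraph := SGraph kept_edge_sym kept_edge_irr.

Lemma delete_leaf_edgeE (x y : delete_leaf) : edge x y =
  edge (val x) (val y) || [&& x != y, edge (val x) p & edge p (val y)].
Proof. by []. Qed.

Let acyc : acyclic T.
Proof. by case: T_tree. Qed.

Let up : edge u p.
Proof. by rewrite u_nbr eqxx. Qed.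

Lemma keptP (x : T) : [\/ x = u, x = p | exists z : delete_leaf, x = val z].
Proof.
have [-> | xu] := eqVneq x u; first by constructor 1.
have [-> | xp] := eqVneq x p; first by constructor 2.
have xP : (x != u) && (x != p) by rewrite xu.
by constructor 3; exists (exist _ x xP).
Qed.

Lemma kept_neq (z : delete_leaf) : (val z != u) * (val z != p).
Proof. by case/andP: (valP z). Qed.

Lemma kept_neqF (z : delete_leaf) :
  ((val z == u) = false) * ((val z == p) = false).
Proof. by split; apply/negbTE; rewrite kept_neq. Qed.

Lemma kept_not_nbr (z : delete_leaf) : edge u (val z) = false.
Proof. by rewrite u_nbr kept_neqF. Qed.

Lemma parent_nbrs : exists a b : delete_leaf, a != b /\
  forall x : T, edge p x = [|| x == u, x == val a | x == val b].
Proof.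
have pu : u \in [set y | edge p y] by rewrite inE edge_sym.
have /cards2P [a [b [ab Nab]]] : #|[set y | edge p y] :\ u| == 2.
  by move: p_deg; rewrite /degree (cardsD1 u) pu => /eqP; rewrite eqSS.
have inN x : (x != u) && edge p x = (x == a) || (x == b).
  by have /setP/(_ x) := Nab; rewrite !inE.
have keep x : (x == a) || (x == b) -> (x != u) && (x != p).
  by rewrite -inN => /andP [-> /edge_neq]; rewrite eq_sym.
have aP : (a != u) && (a != p) by apply: keep; rewrite eqxx.
have bP : (b != u) && (b != p) by apply: keep; rewrite eqxx orbT.
exists (exist _ a aP), (exist _ b bP); split=> [|x /=].
  by apply: contraNneq ab => -[->].
by rewrite -inN; case: (x =P u) => [-> |] //=; rewrite edge_sym up.
Qed.

(** A retraction of the old tree onto the new one; with [q] a neighbour of [p], it contracts [u] and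
    [p] into [q]. *)
Definition collapse (q : delete_leaf) (x : T) : delete_leaf := insubd q x.

Lemma collapse_val q (z : delete_leaf) : collapse q (val z) = z.
Proof. exact: valKd. Qed.

Lemma collapse_removed q x : x = u \/ x = p -> collapse q x = q.
Proof.
move=> xup; apply: val_inj; rewrite /collapse val_insubd.
by case: xup => ->; rewrite eqxx ?andbF.
Qed.

(** Carries walks of the old tree to the new one: an edge at [u] can only lead to [p] and collapses,
    while an edge from [p] to a kept vertex becomes trivial or an [R]-step from [q]. *)
Lemma connect_collapse (E : rel T) (R : rel delete_leaf) (q : delete_leaf) :
  symmetric E -> symmetric R -> subrel E (@edge T) ->
  (forall x y : delete_leaf, E (val x) (val y) -> R x y) ->
  (forall y : delete_leaf, E p (val y) -> y = q \/ R q y) ->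
  forall x y, connect E x y -> connect R (collapse q x) (collapse q y).
Proof.
move=> E_sym R_sym E_edge E_R E_q; apply: connect_hom => x y Exy.
have half z (y' : delete_leaf) : z = u \/ z = p -> E z (val y') ->
    connect R (collapse q z) (collapse q (val y')).
  move=> zup Ezy; rewrite collapse_removed // collapse_val.
  case: zup Ezy => [-> /E_edge | ->]; first by rewrite kept_not_nbr.
  by case/E_q => [-> | /connect1].
case: (keptP x) Exy => [xu | xp | [x' ->]];
  case: (keptP y) => [yu | yp | [y' ->]];
  try by rewrite ?(collapse_removed q (or_introl xu)) ?(collapse_removed q (or_intror xp))
      ?(collapse_removed q (or_introl yu)) ?(collapse_removed q (or_intror yp)).
- by apply: half; left.
- by apply: half; right.
- rewrite E_sym (sym_connect_sym R_sym); apply: half; by left.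
- rewrite E_sym (sym_connect_sym R_sym); apply: half; by right.
- by move/E_R/connect1; rewrite !collapse_val.
Qed.

(* If [s] and [t] were joined only through [p], then [t'] is [p]. *)
Lemma delete_leaf_side (s t : delete_leaf) : edge s t ->
  exists t' : T, edge (val s) t' /\ ~~ connect (edge_del s t) s t /\
    forall x, connect (edge_del s t) s x =
              connect (edge_del (val s) t') (val s) (val x).
Proof.
have [a [b [ab pE]]] := parent_nbrs.
have pV (y : delete_leaf) : edge p (val y) = (y == a) || (y == b).
  by rewrite pE kept_neqF !(inj_eq val_inj).
rewrite delete_leaf_edgeE => /orP [st | /and3P [s_t sp pt]].
  have eq_connect x y : connect (edge_del s t) x y =
      connect (edge_del (val s) (val t)) (val x) (val y).
    apply/idP/idP => [|/(@connect_collapse _ (edge_del s t) a) h].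
      apply: connect_hom => x' y'.
      rewrite edge_delE delete_leaf_edgeE => /and3P [/orP [xy n1 n2 | /and3P [_ xp py] _ _]].
        by apply: connect1;
          rewrite edge_delE xy !xpair_eqE !(inj_eq val_inj) -!xpair_eqE n1.
      apply: (@connect_trans _ _ p); apply: connect1;
        rewrite edge_delE ?xp ?py !xpair_eqE;
      by rewrite !(eq_sym p) !kept_neqF ?andbF.
    rewrite -(collapse_val a x) -(collapse_val a y); apply: h.
    - exact: edge_del_sym.
    - exact: edge_del_sym.
    - by move=> x' y'; rewrite edge_delE => /and3P [].
    - move=> x' y';
      rewrite !edge_delE delete_leaf_edgeE !xpair_eqE !(inj_eq val_inj).
      by case/and3P => -> -> ->.
    - move=> y' /[!edge_delE] /and3P [+ _ _]; rewrite pV.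
      have [-> | ya] := eqVneq y' a; first by left.
      move/eqP=> y'b; right; rewrite y'b delete_leaf_edgeE ab.
      rewrite [edge _ p]edge_sym !pV !eqxx !orbT /=.
      (* Here [s] and [t] are adjacent in [T], whereas [a] and [b] are not, so the new edge between
         [a] and [b] survives the deletion. *)
      have nab : ~~ edge (val a) (val b).
        apply: (acyclic_no_triangle acyc (y := p));
          last by rewrite pV eqxx orbT.
        by rewrite edge_sym pV eqxx.
      apply/andP; split; apply: contraNneq nab => -[-> ->] //.
      by rewrite edge_sym.
  exists (val t); split=> //; split=> //.
  by rewrite eq_connect; apply: acyclic_bridge.
have nst : ~~ edge (val s) (val t) by apply: (acyclic_no_triangle acyc sp pt).
have pst (y : delete_leaf) : edge p (val y) -> y = s \/ y = t.
  move: s_t sp pt; rewrite edge_sym !pV => neq /orP [] /eqP es /orP [] /eqP et;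
    move: neq; rewrite es et ?eqxx // => _ /orP [] /eqP ->; auto.
(* Now the edge between [s] and [t] is the new one. Deleting it amounts to deleting its half between
   [s] and [p], with [p] collapsed to [t]. *)
have eq_connect x y : connect (edge_del s t) x y =
    connect (edge_del (val s) p) (val x) (val y).
  apply/idP/idP => [|/(@connect_collapse _ (edge_del s t) t) h].
    apply: connect_hom => x' y'.
    rewrite edge_delE delete_leaf_edgeE => /and3P [/orP [xy _ _|]].
      by apply: connect1; rewrite edge_delE xy !xpair_eqE !kept_neqF andbF.
    case/and3P => neq xp /pst py; move: xp; rewrite edge_sym => /pst xp.
    by case: py neq => ->; case: xp => ->; rewrite ?eqxx.
  rewrite -(collapse_val t x) -(collapse_val t y); apply: h.
  - exact: edge_del_sym.
  - exact: edge_del_sym.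
  - by move=> x' y'; rewrite edge_delE => /and3P [].
  - move=> x' y'; rewrite !edge_delE delete_leaf_edgeE => /and3P [xy _ _].
    rewrite xy /=; apply/andP; split; apply: contraNneq nst => -[<- <-] //.
    by rewrite edge_sym.
  - move=> y' /[!edge_delE] /and3P [/pst [-> |]]; last by left.
    by rewrite !xpair_eqE !eqxx.
exists p; split=> //; split=> //.
apply: contra (acyclic_bridge acyc sp) => /[!eq_connect] /connect_trans; apply.
apply: connect1;
  rewrite edge_delE edge_sym pt !xpair_eqE !kept_neqF !(inj_eq val_inj).
by rewrite eq_sym (negPf s_t).
Qed.

Lemma delete_leaf_connected (x y : delete_leaf) : connect (@edge _) x y.
Proof.
have [a [b [ab pE]]] := parent_nbrs.
have [_ T_conn _] := T_tree.
rewrite -(collapse_val a x) -(collapse_val a y).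
apply: (@connect_collapse (@edge T)) (T_conn _ _) => //.
- exact: edge_sym.
- exact: edge_sym.
- by move=> x' y' xy; rewrite delete_leaf_edgeE xy.
- move=> y'; rewrite pE kept_neqF !(inj_eq val_inj) /= => /orP [] /eqP ->;
  first by left.
  by right; rewrite /kept_edge ab [edge _ p]edge_sym !pE !eqxx !orbT.
Qed.

Lemma delete_leaf_tree : is_tree delete_leaf.
Proof.
split; last 2 first.
- exact: delete_leaf_connected.
- by apply: bridges_acyclic => s t /delete_leaf_side [t' [_ []]].
- by have [a _] := parent_nbrs; apply/card_gt0P; exists a.
Qed.

(** A vertex not adjacent to [p] keeps its neighbours. A neighbour of [p] trades [p] for the other
    kept neighbour [c] of [p], which was not adjacent to it before, as there are no triangles. *)
Lemma delete_leaf_degree (x : delete_leaf) : degree x = degree (val x).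
Proof.
have [a [b [ab pE]]] := parent_nbrs.
rewrite /degree -(card_imset _ val_inj).
have [xp | xp] := boolP (edge (val x) p); last first.
  congr #|pred_of_set _|; apply/setP => y; rewrite inE;
    apply/imsetP/idP => [[z + ->] | xy].
    by rewrite inE delete_leaf_edgeE (negPf xp) andbF orbF.
  case: (keptP y) xy => [-> | -> | [z ->]] xy.
  - by move: xy; rewrite edge_sym kept_not_nbr.
  - by rewrite xy in xp.
  - by exists z; rewrite // inE delete_leaf_edgeE xy.
have [c pc] : exists c : delete_leaf,
    forall y : delete_leaf, (x != y) && edge p (val y) = (y == c).
  move: xp;
    rewrite edge_sym pE kept_neqF !(inj_eq val_inj) /= => /orP [] /eqP ->.
    exists b => y; rewrite pE kept_neqF !(inj_eq val_inj).
    by have [-> | ya] := eqVneq y a; rewrite ?eqxx ?(negPf ab) // eq_sym ya.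
  exists a => y; rewrite pE kept_neqF !(inj_eq val_inj).
  have [-> | _] := eqVneq y b; first by rewrite ?eqxx /= [RHS]eq_sym (negPf ab).
  by rewrite /= orbF.
have -> : [set val y | y in [set y | edge x y]] = val c |: [set y | edge (val x) y] :\ p.
  apply/setP => y; rewrite !inE; apply/imsetP/idP => [[z + ->] | ].
    rewrite inE delete_leaf_edgeE xp /= pc kept_neqF (inj_eq val_inj).
    by rewrite orbC.
  case/orP => [/eqP -> | /andP [yp xy]].
    by exists c; rewrite // inE delete_leaf_edgeE xp /= pc eqxx orbT.
  case: (keptP y) xy => [-> | yp' | [z ->]] xy.
  - by move: xy; rewrite edge_sym kept_not_nbr.
  - by rewrite yp' eqxx in yp.
  - by exists z; rewrite // inE delete_leaf_edgeE xy.
rewrite cardsU1 (cardsD1 p [set y | edge _ y]) !inE xp;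
  congr (nat_of_bool _ + _).
rewrite negb_and; apply/orP; right.
apply: (acyclic_no_triangle acyc xp).
by have := pc c; rewrite eqxx => /andP [].
Qed.

Lemma delete_leaf_cubic : is_cubic_tree T -> is_cubic_tree delete_leaf.
Proof.
case=> _ T_cubic; split=> [|x]; first exact: delete_leaf_tree.
by rewrite /leaf delete_leaf_degree; apply: T_cubic.
Qed.

End DeleteLeaf.

(** * Restricting and constructing labelled cubic trees *)

(** The inverse of the leaf bijection of a decomposition, stated without a subtype of leaves so that
    it can be restricted along injections. *)
Definition leaf_labelling (V : finType) (T : sgraph) (l : V -> T) : Prop :=
  injective l /\ forall x, leaf x = (x \in codom l).

(** The second vertex [w] excludes the one-vertex tree, whose leaf has no neighbour. *)
Lemma leaf_neighbour (T : sgraph) (u w : T) :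
  is_tree T -> leaf u -> w != u -> exists p, forall x, edge u x = (x == p).
Proof.
move=> [_ T_conn _] u_leaf wu.
have /connectP [[|p c] /= + w_last] := T_conn u w;
  first by rewrite w_last eqxx in wu.
case/andP => up _; exists p => x.
apply/idP/eqP => [ux | -> //].
by move/card_le1_eqP: u_leaf; apply; rewrite inE.
Qed.

(** Two adjacent leaves form a whole connected component. In a larger tree the neighbour of a leaf
    is therefore internal and can be suppressed. *)
Lemma adjacent_leaves (T : sgraph) (u p : T) :
  is_tree T -> leaf u -> leaf p -> edge u p -> #|T| <= 2.
Proof.
move=> [_ T_conn _] u_leaf p_leaf up.
have closed_up : closed (@edge T) [set u; p].
  apply: (intro_closed (@edge_connect_sym T)) => x y xy.
  rewrite !inE => /orP [] /eqP ex; subst x; apply/orP; [right | left];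
    apply/eqP.
    by move/card_le1_eqP: u_leaf; apply; rewrite inE.
  by move/card_le1_eqP: p_leaf; apply; rewrite inE // edge_sym.
apply: (@leq_trans #|[set u; p]|); last by rewrite cards2; case: (u != p).
apply/subset_leq_card/subsetP => x _.
by rewrite -(closed_connect closed_up (T_conn u x)) !inE eqxx.
Qed.

Definition point_graph : sgraph :=
  @SGraph unit (fun _ _ => false) (fun _ _ => erefl) (fun _ => erefl).

Lemma point_degree (x : point_graph) : degree x = 0.
Proof. by apply/eqP; rewrite cards_eq0; apply/eqP/setP => y; rewrite !inE. Qed.

Lemma point_graph_cubic : is_cubic_tree point_graph.
Proof.
split; last by move=> x; rewrite /leaf point_degree.
split; first by rewrite card_unit.
- by move=> [] []; apply: connect0.
- by move=> [|x [|y c]] //= _ /andP [].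
Qed.

Lemma point_labelling (V : finType) :
  #|V| = 1 -> leaf_labelling (fun _ : V => tt : point_graph).
Proof.
move=> V1; split=> [x y _ | []].
  have /card_le1_eqP V_le1 : #|V| <= 1 by rewrite V1.
  exact: V_le1.
have /card_gt0P [v _] : 0 < #|V| by rewrite V1.
by rewrite /leaf point_degree; symmetry; apply/codomP; exists v.
Qed.

Lemma restrict_cubic_tree (V V' : finType) (f : V' -> V)
    (T : sgraph) (l : V -> T) :
  injective f -> 0 < #|V'| -> is_cubic_tree T -> leaf_labelling l ->
  exists (T' : sgraph) (l' : V' -> T'),
    [/\ is_cubic_tree T', leaf_labelling l' &
      forall s t : T', edge s t -> exists s' t' : T, edge s' t' /\
        forall v, (l' v \in edge_comp s t) = (l (f v) \in edge_comp s' t')].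
Proof.
move En : #|V| => n.
elim: n V f T l En => [|n IH] V f T l En f_inj V'_gt0 T_cubic [l_inj l_leaf].
  by have := leq_card f f_inj; rewrite En leqNgt V'_gt0.
have [f_surj | ] := boolP [forall v, v \in codom f].
  exists T, (l \o f); split=> [//||s t st].
    split=> [|x]; first exact: inj_comp.
    rewrite l_leaf; apply/codomP/codomP => [[v ->] | [v ->]];
      last by exists (f v).
    by have /codomP [v' ->] := forallP f_surj v; exists v'.
  by exists s, t.
rewrite negb_forall => /existsP [v0 v0_out].
(* Treated apart because a tree with two vertices has no internal vertex to suppress; the one-vertex
   tree has no edges to check. Otherwise [v0] and the image of [f] give at least three leaves. *)
have [V'1 | V'_neq1] := eqVneq #|V'| 1.
  exists point_graph, (fun=> tt); split=> //.
  - exact: point_graph_cubic.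
  - exact: point_labelling.
have V'_gt1 : 1 < #|V'| by lia.
have V_gt2 : 2 < #|V|.
  apply: leq_ltn_trans V'_gt1 _; rewrite -(card_codom f_inj).
  by apply/proper_card/properP; split; [apply/subsetP | exists v0].
have T_gt2 : 2 < #|T| by apply: leq_trans V_gt2 (leq_card l l_inj).
have leaf_l v : leaf (l v) by rewrite l_leaf codom_f.
set u := l v0; have T_tree := T_cubic.1.
have [w wu] : exists w, w != u.
  have /card_gt0P [v' _] := V'_gt0; exists (l (f v')).
  by rewrite (inj_eq l_inj); apply: contraNneq v0_out => <-; apply: codom_f.
have [p u_nbr] := leaf_neighbour T_tree (leaf_l v0) wu.
have p_nleaf : ~~ leaf p.
  apply/negP => p_leaf; move: T_gt2; rewrite ltnNge.
  by rewrite (adjacent_leaves T_tree (leaf_l v0) p_leaf) // u_nbr.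
have p_deg := T_cubic.2 p p_nleaf.
pose V1 : finType := {v : V | v != v0}.
pose T1 := delete_leaf u p.
have l_kept (v : V1) : (l (val v) != u) && (l (val v) != p).
  rewrite (inj_eq l_inj) (valP v) /=.
  by apply: contraNneq p_nleaf => <-.
pose l1 (v : V1) : T1 := exist _ (l (val v)) (l_kept v).
have f_out v' : f v' != v0 by apply: contraNneq v0_out => <-; apply: codom_f.
pose f1 (v' : V') : V1 := exist _ (f v') (f_out v').
have V1n : #|V1| = n.
  by rewrite card_sig -(eq_card (in_set _)) cardsE cardC1 En.
have f1_inj : injective f1 by move=> x y [] /f_inj.
have l1_lab : leaf_labelling l1.
  split=> [x y [] /l_inj /val_inj // | x].
  rewrite /leaf (delete_leaf_degree T_tree u_nbr p_deg) -/(leaf _) l_leaf.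
  apply/codomP/codomP => [[v xv] | [v ->]]; last by exists (val v).
  have vP : v != v0.
    by apply/eqP => e; case/andP: (valP x); rewrite /= -/(val x) xv e eqxx.
  by exists (exist _ v vP); apply: val_inj.
have [T' [l' [T'_cubic l'_lab sides]]] :=
  IH V1 f1 T1 l1 V1n f1_inj V'_gt0 (delete_leaf_cubic T_tree u_nbr p_deg T_cubic) l1_lab.
exists T', l'; split=> // s t /sides [s1 [t1 [st1 eq1]]].
have [t2 [st2 [_ eq2]]] := delete_leaf_side T_tree u_nbr p_deg st1.
by exists (val s1), t2; split=> // v; rewrite eq1 !inE eq2.
Qed.

(** * Cubic trees with any positive number of leaves *)

Section HeapTree.
Variable k : nat.

Definition heap_edge : rel 'I_k.+1.*2 := fun x y =>
  (x != y) && ((y == x./2 :> nat) || (x == y./2 :> nat)).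

Lemma heap_edge_sym : symmetric heap_edge.
Proof. by move=> x y; rewrite /heap_edge eq_sym orbC. Qed.

Lemma heap_edge_irr : irreflexive heap_edge.
Proof. by move=> x; rewrite /heap_edge eqxx. Qed.

(* A binary heap rooted at 1, with an extra leaf 0 above the root. *)
Definition heap_graph : sgraph := SGraph heap_edge_sym heap_edge_irr.

Lemma heap_edgeE (x y : heap_graph) : edge x y =
  (x != y :> nat) && ((y == x./2 :> nat) || (x == y./2 :> nat)).
Proof. by []. Qed.

(** For [x] from 1 to [k], the parent and both children are in range. The leaves are 0 and the
    numbers from [k + 1] to [2 * k + 1], hence [k + 2] in all. *)
Lemma heap_degree (x : heap_graph) :
  degree x = if (x == 0 :> nat) || (k < x) then 1 else 3.
Proof.
have xk : x < k.+1.*2 := ltn_ord x.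
have mk i : i < k.+1.*2 -> exists y : heap_graph, y = i :> nat.
  by move=> ik; exists (Ordinal ik).
rewrite /degree; case: ifP => [|x_in].
  case: (posnP x) => [x0 _ | x_gt0 /= x_gtk].
    have [y y1] := mk 1 ltac:(lia).
    apply/eqP/cards1P; exists y; apply/setP => z;
      rewrite !inE /= /heap_edge -!val_eqE /= y1.
    lia.
  have [y yx] := mk x./2 ltac:(lia).
  apply/eqP/cards1P; exists y; apply/setP => z;
    rewrite !inE /= /heap_edge -!val_eqE /= yx.
  have := ltn_ord z; lia.
have [y yE] := mk x./2 ltac:(lia).
have [a aE] := mk x.*2 ltac:(lia).
have [b bE] := mk x.*2.+1 ltac:(lia).
have -> : [set z | edge x z] = y |: [set a; b].
  by apply/setP => z; rewrite !inE /= /heap_edge -!val_eqE /= yE aE bE; lia.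
rewrite cardsU1 cards2 !inE -!val_eqE /= yE aE bE; lia.
Qed.

Lemma heap_tree : is_tree heap_graph.
Proof.
split; first by rewrite card_ord.
(* Repeated halving leads every vertex to 0; [m] turns this into strong induction on [x]. *)
- have to0 m (x z : heap_graph) : x <= m -> z = 0 :> nat -> connect (@edge _) x z.
    elim: m x => [|m IH] x xm z0.
      by rewrite (_ : x = z) //; apply: val_inj; rewrite /= z0; lia.
    have [x0 | x_gt0] := posnP x; first by apply: IH => //; lia.
    have hk : x./2 < k.+1.*2 by have := ltn_ord x; lia.
    apply: (@connect_trans _ _ (Ordinal hk : heap_graph));
      last by apply: IH => //=; lia.
    by apply: connect1; rewrite heap_edgeE /=; lia.
  have h0 : 0 < k.+1.*2 by [].
  move=> x y; apply: (@connect_trans _ _ (Ordinal h0 : heap_graph)).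
    exact: to0 (leqnn x) _.
  by rewrite edge_connect_sym; apply: to0 (leqnn y) _.
(* The largest vertex of a cycle would have two smaller neighbours. *)
move=> c c_size c_cycle.
have [x0 x0c] : exists x, x \in c by case: c c_size {c_cycle} => // x c _;
  exists x; rewrite mem_head.
pose m := [arg max_(i > x0 in c) (i : nat)].
have [mc m_max] : m \in c /\ forall y : heap_graph, y \in c -> y <= m.
  by rewrite /m; case: arg_maxnP => // i ic i_max; split.
have up (y : heap_graph) : y \in c -> edge m y -> y = m./2 :> nat.
  by move=> /m_max ym; rewrite heap_edgeE; lia.
case: (rot_to mc) => i r rotE.
have in_c y : y \in m :: r -> y \in c by rewrite -rotE mem_rot.
have : ucycle (@edge heap_graph) (m :: r) by rewrite -rotE rot_ucycle.
have : 2 < size (m :: r) by rewrite -rotE size_rot.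
case: r {rotE} in_c => [|y [|z r]] // in_c _ /andP [/= /and3P [my _ +]].
rewrite rcons_path heap_edge_sym => /andP [_ m_last] /and3P [_ + _].
have -> : y = last z r.
  apply: ord_inj; rewrite (up _ _ my) ?(up _ _ m_last) //; apply: in_c.
    by rewrite in_cons in_cons mem_last !orbT.
  by rewrite in_cons mem_head orbT.
by rewrite mem_last.
Qed.

Lemma heap_cubic : is_cubic_tree heap_graph.
Proof.
split=> [|x]; first exact: heap_tree.
by rewrite /leaf heap_degree; case: ifP.
Qed.

Lemma heap_labelling (V : finType) :
  #|V| = k.+2 -> exists l : V -> heap_graph, leaf_labelling l.
Proof.
move=> Vk.
have rank_lt (v : V) : enum_rank v < k.+2 by rewrite -Vk.
(* Rank 0 labels the extra leaf 0; the ranks from 1 to [k + 1] label the leaves after [k] in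
   order. *)
have lP (v : V) : (if enum_rank v == 0 :> nat then 0 else k + enum_rank v) < k.+1.*2.
  by have := rank_lt v; case: ifP; lia.
exists (fun v => Ordinal (lP v)); split=> [v w /(congr1 val) /= | x].
  by move=> e; apply/enum_rank_inj/ord_inj; move: e; clear;
    do 2 case: eqP => /=; lia.
have -> : leaf x = (x == 0 :> nat) || (k < x).
  by rewrite /leaf heap_degree; case: ifP.
have xk : x < k.+1.*2 := ltn_ord x.
apply/idP/codomP => [x_leaf | [v ->] /=]; last by case: ifP => //; lia.
have [j jE] : exists j : 'I_#|V|, j = (if x == 0 :> nat then 0 else x - k) :> nat.
  have jP : (if x == 0 :> nat then 0 else x - k) < #|V| by rewrite Vk;
    case: eqP; lia.
  by exists (Ordinal jP).
exists (enum_val j); apply: ord_inj; rewrite /= enum_valK jE.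
move: x_leaf; case: (posnP x) => [-> // | x_gt0].
by move=> /= x_gtk; case: eqP; lia.
Qed.

End HeapTree.

Lemma labelled_tree_exists (V : finType) : 0 < #|V| ->
  exists (T : sgraph) (l : V -> T), is_cubic_tree T /\ leaf_labelling l.
Proof.
case En : #|V| => [|[|k]] // _.
  by exists point_graph, (fun=> tt); split;
    [apply: point_graph_cubic | apply: point_labelling].
have [l l_lab] := heap_labelling En.
by exists (heap_graph k), l; split=> //; apply: heap_cubic.
Qed.

(** * Cycle decompositions as labelled trees, and the final comparison *)

Lemma labelling_decomposition (D : digraph) (T : sgraph) (l : D -> T) :
  is_cubic_tree T -> leaf_labelling l ->
  exists d : cycle_decomposition D, width d =
    \max_(e : T * T | edge e.1 e.2)
       cycle_porosity [set v | l v \in edge_comp e.1 e.2].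
Proof.
move=> T_cubic [l_inj l_leaf].
have leaf_l v : leaf (l v) by rewrite l_leaf codom_f.
have leaf_codom (x : {x : T | leaf x}) : val x \in codom l by rewrite -l_leaf (valP x).
pose dmap x := iinv (leaf_codom x).
have dmapE x : l (dmap x) = val x by apply: f_iinv.
pose lsub v : {x : T | leaf x} := exist _ (l v) (leaf_l v).
have dmapK : cancel dmap lsub by move=> x; apply: val_inj; rewrite /= dmapE.
have lsubK : cancel lsub dmap by move=> v; apply: l_inj; rewrite dmapE.
exists (CycleDecomposition T_cubic (Bijective dmapK lsubK)).
apply: eq_bigr => -[s t] _ /=; congr (cycle_porosity _); apply/setP => v.
rewrite /leaf_side inE; apply/imsetP/idP => [[x + ->] | v_in].
  by rewrite inE dmapE.
by exists (lsub v); [rewrite inE | apply: esym (lsubK v)].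
Qed.

Lemma decomposition_labelling (D : digraph) (d : cycle_decomposition D) :
  exists2 l : D -> dec_tree d, leaf_labelling l &
    forall s t, leaf_side s t = [set v | l v \in edge_comp s t].
Proof.
have [g dK gK] := dec_bij d.
exists (fun v => val (g v)).
  split=> [v w /val_inj /(can_inj gK) // | x].
  apply/idP/codomP => [x_leaf | [v ->]]; last exact: valP.
  by exists (dec_map (exist _ x x_leaf)); rewrite dK.
move=> s t; apply/setP => v; rewrite inE; apply/imsetP/idP => [[x + ->] | v_in].
  by rewrite inE dK.
by exists (g v); [rewrite inE | rewrite gK].
Qed.

Lemma cycw_le (D : digraph) (d : cycle_decomposition D) : cycw D <= width d.
Proof.
rewrite /cycw; case: pselect => // ex; case: ex_minnP => k _; apply.
by apply/asboolP; exists d.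
Qed.

(** The existence of a labelled cubic tree rules out the default branch of [cycw], so the minimum is
    a real width. *)
Lemma cycw_attained (D : digraph) :
  0 < #|D| -> exists d : cycle_decomposition D, width d = cycw D.
Proof.
move=> /labelled_tree_exists [T [l [T_cubic /(labelling_decomposition T_cubic) [d _]]]].
rewrite /cycw; case: pselect => [ex | []].
  by case: ex_minnP => k /asboolP.
by exists (width d); apply/asboolP; exists d.
Qed.

Lemma cycw_empty (D : digraph) : #|D| = 0 -> cycw D = 0.
Proof.
move=> D0; rewrite /cycw; case: pselect => // ex; case: ex_minnP => k.
move=> /asboolP [d <-] _; apply/eqP; rewrite -leqn0.
apply/bigmax_leqP => e _; apply/porosity_le_iff => s _.
by rewrite -D0 max_card.
Qed.

Theorem theorem3p12 (D D' : digraph) (hminor : butterfly_minor D' D) :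
  cycw D' <= cycw D.
Proof.
have [f f_inj f_por] := minor_porosity_embeds hminor.
have [D'0 | D'_gt0] := posnP #|D'|; first by rewrite cycw_empty.
have [d <-] := cycw_attained (leq_trans D'_gt0 (leq_card f f_inj)).
have [l l_lab side_l] := decomposition_labelling d.
have [T' [l' [T'_cubic l'_lab sides]]] :=
  restrict_cubic_tree f_inj D'_gt0 (dec_cubic d) l_lab.
have [d' width_d'] := labelling_decomposition T'_cubic l'_lab.
apply: leq_trans (cycw_le d') _; rewrite width_d'.
apply/bigmax_leqP => -[s t] /= /sides [s' [t' [st' eq_side]]].
apply: leq_trans (leq_bigmax_cond (s', t') st').
(* The side of the new tree edge is exactly the preimage under [f] of the side of the old edge. *)
rewrite side_l; apply: leq_trans (f_por _); rewrite leq_eqVlt; apply/orP; left.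
by apply/eqP; congr (cycle_porosity _); apply/setP => v; have := eq_side v;
  rewrite !inE.
Qed.
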